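(* Let $k$ be an algebraically closed field of characteristic $p>2$ and let $N \ge 3$. Let $X$ be a smooth projective curve over $k$. Suppose there exist a local parameter $x \in k(X)$ at some point of $X$ and an automorphism $\sigma \in \mathrm{Aut}(X)$ such that (a) $\sigma^*x - x \in k\setminus\{0\}$; (b) the order of $\sigma$ is $p$. Then there exists a morphism $\varphi: X \rightarrow \mathbb{P}^N$, birational onto its image, such that (1) $\varphi(X)$ is not contained in any hyperplane of $\mathbb{P}^N$; (2) $\sigma$ is non-classical with respect to $\varphi$; (3) the Gauss map of $\varphi(X)$ is birational onto its image.
   Context: $\frac{d}{dx}$ denotes the derivation of $k(X)$ with respect to the separating variable $x$. For a smooth projective curve $X$ and a morphism $\varphi: X \to \mathbb{P}^N$ ($N\ge 2$) birational onto its image, written in homogeneous coordinates as $\varphi=(\varphi_0:\cdots:\varphi_N)$ with $\varphi_i \in k(X)$, an automorphism $\sigma \in \mathrm{Aut}(X)\setminus\{1\}$ is called non-classical with respect to $\varphi$ if $\varphi(\sigma(P)) \in \langle \varphi(P), \frac{d\varphi}{dx}(P)\rangle$ (the projective line spanned by these two points, where $\frac{d\varphi}{dx}=(\frac{d\varphi_0}{dx}:\cdots:\frac{d\varphi_N}{dx})$) for a general point $P$ of $X$, where $x$ is a local parameter at some point of $X$. The Gauss map of a projective curve $C \subset \mathbb{P}^N$ is the rational map $C \dashrightarrow \mathbb{G}(1,\mathbb{P}^N)$ sending a smooth point $Q$ to its projective tangent line $T_QC$. *)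

(* Defs.v *)
From HB Require Import structures.
From mathcomp Require Import all_boot all_order all_algebra.
Set Implicit Arguments. Unset Strict Implicit. Unset Printing Implicit Defensive.
Import Order.TTheory GRing.Theory Num.Theory.
Local Open Scope ring_scope.

(* A smooth projective curve X over an algebraically closed field k is
   encoded by its function field K = k(X), a field containing k via [iota]. *)

Section FF.
Variables (k : fieldType) (K : fieldType) (iota : {rmorphism k -> K}).

Definition subfield_closed (P : K -> Prop) : Prop :=
  P 0 /\ P 1 /\ (forall a b, P a -> P b -> P (a + b)) /\
  (forall a, P a -> P (- a)) /\ (forall a b, P a -> P b -> P (a * b)) /\
  (forall a, P a -> P a^-1).

Definition generates_over (S : K -> Prop) : Prop :=
  forall P : K -> Prop, subfield_closed P -> (forall c, P (iota c)) ->
    (forall s, S s -> P s) -> forall y, P y.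

Definition transcendental (t : K) : Prop :=
  forall q : {poly k}, q != 0 -> (map_poly iota q).[t] != 0.

Definition eval2 (F : {poly {poly k}}) (t y : K) : K :=
  (map_poly (fun q : {poly k} => (map_poly iota q).[t]) F).[y].

Definition function_field : Prop :=
  (exists s : seq K, generates_over (fun y => y \in s)) /\
  exists t : K, transcendental t /\
    forall y : K, exists F : {poly {poly k}}, F != 0 /\ eval2 F t y = 0.

(* normalized discrete valuation of K trivial on k (= a point of X) *)
Definition place_valuation (v : K -> int) : Prop :=
  (forall a b, a != 0 -> b != 0 -> v (a * b) = v a + v b) /\
  (forall a b, a != 0 -> b != 0 -> a + b != 0 -> Num.min (v a) (v b) <= v (a + b)) /\
  (forall c : k, c != 0 -> v (iota c) = 0).

Definition local_parameter (x : K) : Prop :=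
  exists v : K -> int, place_valuation v /\ v x = 1.

(* sigma^* : pull-back by an automorphism of X, i.e. a k-automorphism of K *)
Definition k_automorphism (sigma : {rmorphism K -> K}) : Prop :=
  bijective sigma /\ forall c : k, sigma (iota c) = iota c.

Definition has_order (sigma : K -> K) (p : nat) : Prop :=
  (forall y, iter p sigma y = y) /\ (forall m, (0 < m < p)%N -> exists y, iter m sigma y != y).

Definition kder (D : K -> K) : Prop :=
  (forall a b, D (a + b) = D a + D b) /\
  (forall a b, D (a * b) = a * D b + b * D a) /\
  (forall c : k, D (iota c) = 0).

Variable N : nat.

(* phi = (phi_0 : ... : phi_N) is birational onto its image:
   the affine ratios generate k(X) over k *)
Definition birational_onto_image (phi : 'I_N.+1 -> K) : Prop :=
  (exists i, phi i != 0) /\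
  generates_over (fun y => exists i j, phi j != 0 /\ y = phi i / phi j).

Definition not_in_hyperplane (phi : 'I_N.+1 -> K) : Prop :=
  forall c : 'I_N.+1 -> k, \sum_i iota (c i) * phi i = 0 -> forall i, c i = 0.

(* phi(sigma P) lies on the line spanned by phi(P) and dphi/dx(P), for
   general P: as vectors over K, sigma^* phi = a phi + b dphi/dx *)
Definition non_classical (sigma : K -> K) (phi : 'I_N.+1 -> K) (D : K -> K) : Prop :=
  (exists y, sigma y != y) /\
  exists a b : K, forall i, sigma (phi i) = a * phi i + b * D (phi i).

Definition plucker (phi : 'I_N.+1 -> K) (D : K -> K) (i j : 'I_N.+1) : K :=
  phi i * D (phi j) - phi j * D (phi i).

(* Gauss map birational onto its image: the ratios of the Plucker
   coordinates generate k(phi(X)) = k(X) over k *)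
Definition gauss_birational (phi : 'I_N.+1 -> K) (D : K -> K) : Prop :=
  generates_over (fun y => exists i j l m, plucker phi D l m != 0 /\
                                  y = plucker phi D i j / plucker phi D l m).
End FF.

(* Main.v *)
Require Import Defs.
From HB Require Import structures.
From mathcomp Require Import all_boot all_order all_algebra separable.
From mathcomp Require Import zify ring.
From Stdlib Require Import Classical_Prop.
Import GRing.Theory.
Local Open Scope ring_scope.
Set Implicit Arguments. Unset Strict Implicit. Unset Printing Implicit Defensive.

(* Write sigma x = x + c and let D be the derivation with D x = 1. The functions f
   with sigma f = f + c D f form a vector space over the subfield F = (K^sigma)^p,
   whose elements are fixed by sigma and killed by D; this space contains 1, x and
   f = x^2 - c^(2-p) x^p, for which D f = 2 x. Since v(x) = 1, x is not a p-th
   power, hence x is a separating variable and K = K^p[x]; interpolation gives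
   K = K^sigma[x], so K = F[x]. The primitive element theorem over k(x) then
   yields a in F, transcendental over k, with K = k(x, a). The map
   phi = (1 : x : f : a : a^2 : ...) works: its Pluecker coordinates
   p_01 = 1, p_02 = 2 x and p_13 = - a already generate K, and two applications
   of D show that 1, x, f are independent over the constants of D. *)

(** * Extension of an injective ring morphism to the field of fractions *)

Section FractionLift.
Local Open Scope quotient_scope.
Variables (R : idomainType) (L : fieldType) (f : {rmorphism R -> L}).
Hypothesis f_neq0 : forall a : R, a != 0 -> f a != 0.

Lemma fractionE (q : {fraction R}) : q = tofrac \n_(repr q) / tofrac \d_(repr q).
Proof.
elim/quotW: q => r; set s := repr _.
have nzd : tofrac (\d_s) != 0 by rewrite tofrac_eq0 denom_ratioP.
apply: (mulIf nzd); rewrite divfK //.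
rewrite -[X in X * _](reprK (\pi_{fraction R} r)) -/s !piE; apply/eqmodP => /=.
rewrite FracField.equivfE /= !numden_Ratio ?mulf_neq0 ?oner_eq0 ?denom_ratioP //.
by rewrite !mulr1 mulrC.
Qed.

Lemma fractionP (q : {fraction R}) :
  exists n d : R, d != 0 /\ q = tofrac n / tofrac d.
Proof.
by exists \n_(repr q), \d_(repr q); split; [exact: denom_ratioP | exact: fractionE].
Qed.

(** The value is read off the chosen representative of [q]; [frac_liftE] shows that any other
    representative gives the same one. *)
Definition frac_lift (q : {fraction R}) : L :=
  f \n_(repr q) / f \d_(repr q).

Lemma frac_liftE n d : d != 0 -> frac_lift (tofrac n / tofrac d) = f n / f d.
Proof.
move=> nzd; set q := _ / _; have := fractionE q.
rewrite /frac_lift; move: (denom_ratioP (repr q)).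
set n' := \n_ _; set d' := \d_ _ => nzd' Dq.
apply/eqP; rewrite eqr_div ?f_neq0 // -!rmorphM; apply/eqP; congr (f _).
apply/eqP; rewrite -tofrac_eq !tofracM -eqr_div ?tofrac_eq0 //.
by rewrite -Dq.
Qed.

Lemma frac_lift_is_zmod_morphism : zmod_morphism frac_lift.
Proof.
move=> q r.
have [a [b [nzb ->]]] := fractionP q; have [c [d [nzd ->]]] := fractionP r.
rewrite -mulNr addf_div ?tofrac_eq0 // -!tofracM -tofracN -tofracM -tofracD.
by rewrite !frac_liftE ?mulf_neq0 // -mulNr addf_div ?f_neq0 // !rmorphD !rmorphM rmorphN.
Qed.

Lemma frac_lift_is_monoid_morphism : monoid_morphism frac_lift.
Proof.
split=> [|q r].
  by rewrite -[1]divr1 -tofrac1 frac_liftE ?oner_eq0 // rmorph1 divr1.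
have [a [b [nzb ->]]] := fractionP q; have [c [d [nzd ->]]] := fractionP r.
rewrite mulf_div -!tofracM !frac_liftE ?mulf_neq0 //.
by rewrite mulf_div !rmorphM.
Qed.

Definition frac_morph : {rmorphism {fraction R} -> L} :=
  HB.pack frac_lift
    (GRing.isZmodMorphism.Build _ _ _ frac_lift_is_zmod_morphism)
    (GRing.isMonoidMorphism.Build _ _ _ frac_lift_is_monoid_morphism).

Lemma frac_morph_tofrac a : frac_morph (tofrac a) = f a.
Proof.
by rewrite -[tofrac a]divr1 -tofrac1 /= frac_liftE ?oner_eq0 // rmorph1 divr1.
Qed.

Lemma frac_poly_clear_denom (q : {poly {fraction R}}) :
  exists2 d : R, d != 0 & exists P : {poly R}, tofrac d *: q = map_poly (@tofrac R) P.
Proof.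
elim/poly_ind: q => [|q a [d nzd [P DP]]].
  by exists 1; [exact: oner_neq0 | exists 0; rewrite rmorph0 scaler0].
have [n [e [nze ->]]] := fractionP a.
exists (d * e); first exact: mulf_neq0.
exists (e *: P * 'X + (d * n)%:P).
rewrite rmorphD /= [map_poly _ (_ * 'X)]rmorphM /= map_polyX map_polyC /= map_polyZ -DP.
rewrite scalerDr -!scalerAl scalerA -!tofracM [e * d]mulrC; congr (_ + _).
rewrite -mul_polyC -polyCM !tofracM; congr (_ %:P).
by rewrite mulrA mulrAC mulfK ?tofrac_eq0.
Qed.
End FractionLift.

(** * Polynomials with coefficients in a subfield, and their simple roots *)

Section SubfieldClosed.
Variables (K : fieldType) (S : K -> Prop).
Hypothesis S_field : subfield_closed S.

Let S0 : S 0. Proof. by case: S_field. Qed.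
Let S1 : S 1. Proof. by case: S_field => _ []. Qed.
Let SD a b : S a -> S b -> S (a + b).
Proof. by case: S_field => _ [_ [H _]]; exact: H. Qed.
Let SN a : S a -> S (- a).
Proof. by case: S_field => _ [_ [_ [H _]]]; exact: H. Qed.
Let SM a b : S a -> S b -> S (a * b).
Proof. by case: S_field => _ [_ [_ [_ [H _]]]]; exact: H. Qed.
Let SV a : S a -> S a^-1.
Proof. by case: S_field => _ [_ [_ [_ [_ H]]]]; exact: H. Qed.

Lemma subfield_closedX a n : S a -> S (a ^+ n).
Proof. by move=> Sa; elim: n => [|n IHn]; rewrite ?expr0 // exprS; apply: SM. Qed.

Lemma subfield_closed_sum (I : Type) (r : seq I) (P : pred I) (F : I -> K) :
  (forall i, P i -> S (F i)) -> S (\sum_(i <- r | P i) F i).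
Proof. by move=> SF; elim/big_ind: _. Qed.

Lemma subfield_closed_horner (f : {poly K}) a :
  (forall i, S f`_i) -> S a -> S f.[a].
Proof.
move=> Sf Sa; rewrite horner_coef; apply: subfield_closed_sum => i _.
by apply: SM => //; apply: subfield_closedX.
Qed.

(** Euclid's algorithm, each step of which keeps the coefficients in [S] and the root [a]. The
    induction is on the sum of the sizes. *)
Lemma subfield_closed_common_factor (f g : {poly K}) a :
    (forall i, S f`_i) -> (forall i, S g`_i) -> g != 0 ->
    f.[a] = 0 -> g.[a] = 0 ->
  exists h : {poly K}, [/\ forall i, S h`_i, h %| f, h %| g & h.[a] = 0].
Proof.
have [n] := ubnP (size f + size g); elim: n f g => // n IHn f g.
wlog sz_gf: f g / (size g <= size f)%N => [IHwlog|].
  case: (leqP (size g) (size f)) => [|/ltnW] sz; first exact: IHwlog.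
  move=> szn Sf Sg nzg fa ga.
  have [f0|nzf] := eqVneq f 0.
    by exists g; split=> //; rewrite f0 dvdp0.
  rewrite addnC in szn.
  by have [h [? ? ? ?]] := IHwlog g f sz szn Sg Sf nzf ga fa; exists h.
move=> szn Sf Sg nzg fa ga; have nzf : f != 0.
  by rewrite -size_poly_gt0 (leq_trans _ sz_gf) // size_poly_gt0.
(* [m * g] has the size and leading coefficient of [f], so subtracting it lowers the size. *)
pose m := lead_coef f / lead_coef g *: 'X^(size f - size g).
have nzm : m != 0.
  by rewrite scaler_eq0 mulf_eq0 invr_eq0 !lead_coef_eq0 (negPf nzf)
    (negPf nzg) monic_neq0 ?monicXn.
have szm : size (m * g) = size f.
  rewrite size_proper_mul ?mulf_eq0 ?lead_coef_eq0 ?negb_or ?nzm ?nzg //.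
  rewrite size_scale ?size_polyXn ?addSn /= ?subnK //.
  by apply: contraNneq nzm => m0; rewrite /m m0 scale0r.
have lm : lead_coef (m * g) = lead_coef f.
  by rewrite lead_coefM lead_coefZ lead_coefXn mulr1 divfK ?lead_coef_eq0.
have szf1 : (size (f - m * g)%R < size f)%N.
  rewrite ltnNge; apply/negP => le_f.
  have sz1 : size (f - m * g) = size f.
    apply/eqP; rewrite eqn_leq le_f andbT (leq_trans (size_polyD _ _)) //.
    by rewrite size_polyN szm maxnn.
  have := lead_coef_eq0 (f - m * g); rewrite -size_poly_eq0 sz1 size_poly_eq0.
  rewrite (negPf nzf) {1}/lead_coef sz1 coefB -/(lead_coef f) -lm /lead_coef.
  by rewrite szm subrr eqxx.
have [||||||h [Sh hf hg ha]] := IHn (f - m * g) g => //.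
- by rewrite (leq_trans _ (ltnSE szn)) // ltn_add2r.
- move=> i; rewrite coefB -scalerAl coefZ coefXnM.
  apply: SD => //; apply: SN; apply: SM; last by case: ifP.
  by apply: SM; [exact: Sf | apply: SV; exact: Sg].
- by rewrite hornerD hornerN hornerM fa ga mulr0 subr0.
exists h; split=> //.
by rewrite -(subrK (m * g) f) dvdp_addr ?dvdp_mull.
Qed.

(** Both [f] and $X^p - a^p = (X - a)^p$ have coefficients in [S] and vanish at [a], so they share a
    factor over [S] associate to $(X - a)^j$ with $j \ge 1$. As [a] is a simple root of [f], $j =
    1$, and the root of a linear polynomial over [S] lies in [S]. *)
Lemma simple_root_in_subfield p (f : {poly K}) a :
    p \in [pchar K] -> (forall i, S f`_i) -> f.[a] = 0 -> f^`().[a] != 0 ->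
  S (a ^+ p) -> S a.
Proof.
move=> pcharK Sf fa f'a Sap.
have pcharP : p \in [pchar {poly K}] by rewrite pchar_poly.
have Dg : ('X - a%:P) ^+ p = 'X^p - (a ^+ p)%:P.
  by rewrite -!(pFrobenius_autE pcharP) rmorphB /= !pFrobenius_autE -polyC_exp.
have p_gt0 : (0 < p)%N by rewrite prime_gt0 ?(pcharf_prime pcharK).
have [||||h [Sh hf hg ha]] := @subfield_closed_common_factor f ('X^p - (a ^+ p)%:P) a Sf.
- move=> i; rewrite coefB coefXn coefC; apply: SD; first by case: eqP.
  by apply: SN; case: eqP.
- by rewrite -Dg expf_eq0 p_gt0 polyXsubC_eq0.
- by [].
- by rewrite -Dg hornerE hornerXsubC subrr expr0n eqn0Ngt p_gt0.
move: hg; rewrite -Dg => /dvdp_exp_XsubCP[k _ hk].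
case: k hk => [|[|k]] hk.
- by move: (eqp_root hk a); rewrite expr0 rootC oner_eq0 /root ha eqxx.
- have sz : size h = 2 by rewrite (eqp_size hk) expr1 size_XsubC.
  move: ha; rewrite horner_coef sz big_ord_recl big_ord1 /= expr0 mulr1 expr1 => ha.
  have nz1 : h`_1 != 0.
    by have := lead_coef_eq0 h; rewrite /lead_coef sz /= => ->; rewrite -size_poly_eq0 sz.
  have -> : a = - h`_0 / h`_1.
    apply: (mulIf nz1); rewrite divfK //; apply/eqP; rewrite eq_sym eqr_oppLR.
    by rewrite -addr_eq0 mulrC ha.
  by apply: SM; [apply: SN | apply: SV].
case/negP: f'a; have : ('X - a%:P) ^+ 2 %| f.
  apply: dvdp_trans hf; rewrite (eqp_dvdr _ hk); exact: dvdp_exp2l.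
case/dvdpP => q ->; rewrite expr2 !derivM.
by rewrite !hornerE subrr !(mulr0, mul0r, addr0) /= !mulr0.
Qed.

End SubfieldClosed.

(** * Evaluation of polynomials and algebraicity over k(x) *)

Section Eval.
Variables (k K : fieldType) (iota : {rmorphism k -> K}).

Definition evalp (t : K) (q : {poly k}) : K := (map_poly iota q).[t].

Lemma evalp_is_zmod_morphism t : zmod_morphism (evalp t).
Proof. by move=> q r; rewrite /evalp rmorphB hornerD hornerN. Qed.

Lemma evalp_is_monoid_morphism t : monoid_morphism (evalp t).
Proof. by split=> [|q r]; rewrite /evalp ?rmorph1 ?hornerC // rmorphM hornerM. Qed.

HB.instance Definition _ t :=
  GRing.isZmodMorphism.Build {poly k} K (evalp t) (evalp_is_zmod_morphism t).
HB.instance Definition _ t :=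
  GRing.isMonoidMorphism.Build {poly k} K (evalp t) (evalp_is_monoid_morphism t).

Lemma evalpC t c : evalp t c%:P = iota c.
Proof. by rewrite /evalp map_polyC hornerC. Qed.

Lemma evalpX t : evalp t 'X = t.
Proof. by rewrite /evalp map_polyX hornerX. Qed.

Lemma eval2E F t y : eval2 iota F t y = (map_poly (evalp t) F).[y].
Proof. by []. Qed.

Lemma eval2_horner2 F t y : eval2 iota F t y = (map_poly (map_poly iota) F).[y, t].
Proof.
rewrite -[RHS]/(horner_eval t _) -horner_map.
by rewrite -map_poly_comp /= {2}/horner_eval hornerC.
Qed.

Lemma eval2_swapXY F t y : eval2 iota (swapXY F) t y = eval2 iota F y t.
Proof. by rewrite !eval2_horner2 -swapXY_map horner2_swapXY. Qed.

Lemma eval2_transcendental_neq0 (t : K) (F : {poly {poly k}}) :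
  transcendental iota t -> F != 0 -> map_poly (evalp t) F != 0.
Proof.
move=> tr_t nzF; rewrite -lead_coef_eq0 lead_coef_map_eq; last by rewrite tr_t ?lead_coef_eq0.
by rewrite tr_t // lead_coef_eq0.
Qed.

Section OverX.
Variable x : K.
Hypothesis tr_x : transcendental iota x.

Definition fracx : {rmorphism {fraction {poly k}} -> K} :=
  @frac_morph {poly k} K (evalp x) tr_x.

Lemma fracx_tofrac a : fracx (tofrac a) = evalp x a.
Proof. exact: frac_morph_tofrac. Qed.

Lemma map_fracx_tofrac (P : {poly {poly k}}) :
  map_poly fracx (map_poly (@tofrac _) P) = map_poly (evalp x) P.
Proof. by rewrite -map_poly_comp; apply: eq_map_poly => a; apply: fracx_tofrac. Qed.

(** Clearing denominators translates between relations over k[x] and algebraicity over k(x), where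
    transitivity and the primitive element theorem are available. *)
Lemma eval2_algebraicOver y :
  algebraicOver fracx y <-> exists F, F != 0 /\ eval2 iota F x y = 0.
Proof.
split=> [[q nzq] |[F [nzF Fy]]].
  have [d nzd [P DP]] := frac_poly_clear_denom q.
  move=> /eqP qy; exists P; split.
    apply: contraNneq nzq => P0; move: DP; rewrite P0 map_poly0 => /eqP.
    by rewrite scaler_eq0 tofrac_eq0 (negPf nzd).
  by rewrite eval2E -map_fracx_tofrac -DP map_polyZ hornerZ qy mulr0.
exists (map_poly (@tofrac _) F).
  by rewrite map_poly_eq0_id0 // tofrac_eq0 lead_coef_eq0.
by rewrite map_fracx_tofrac; apply/eqP.
Qed.

(** Exchange argument: the relation between [t] and [x], read with its variables swapped, makes [t]
    algebraic over k(x); then [y], algebraic over k(t), is algebraic over k(x) by transitivity. *)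
Lemma function_field_algebraic y :
  function_field iota -> exists F, F != 0 /\ eval2 iota F x y = 0.
Proof.
move=> [_ [t [tr_t alg_t]]].
have [F [nzF Fx]] := alg_t x; have [G [nzG Gy]] := alg_t y.
have int_t : integralOver fracx t.
  apply/integral_algebraic/eval2_algebraicOver.
  by exists (swapXY F); rewrite swapXY_eq0 eval2_swapXY.
apply/eval2_algebraicOver/integral_algebraic.
apply: (@integral_root _ _ _ (map_poly (evalp t) G)); first exact: eval2_transcendental_neq0.
  exact/eqP.
apply/integral_poly => i; rewrite coef_map.
 apply: integral_horner => //; apply/integral_poly => j; rewrite coef_map.
by rewrite -[X in integralOver _ X](evalpC x) -fracx_tofrac; apply: integral_id.
Qed.

End OverX.
End Eval.

(** * Polynomials that are p-th powers *)

Section PthPower.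
Variables (R : idomainType) (p : nat).
Hypothesis pcharR : p \in [pchar R].

Let p_gt0 : (0 < p)%N. Proof. by rewrite prime_gt0 ?(pcharf_prime pcharR). Qed.

Lemma deriv_eq0_coef (f : {poly R}) i : f^`() = 0 -> ~~ (p %| i)%N -> f`_i = 0.
Proof.
case: i => [|i] f'0; first by rewrite dvdn0.
rewrite (dvdn_pcharf pcharR) => nzi.
have /eqP := coef_deriv f i; rewrite f'0 coef0 eq_sym -mulr_natr mulf_eq0.
by rewrite (negPf nzi) orbF => /eqP.
Qed.

Lemma polyXp (g : {poly R}) :
  g ^+ p = map_poly (pFrobenius_aut pcharR) g \Po 'X^p.
Proof.
have pcharP : p \in [pchar {poly R}] by rewrite pchar_poly.
elim/poly_ind: g => [|g c IHg].
  by rewrite rmorph0 comp_poly0 expr0n eqn0Ngt p_gt0.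
rewrite rmorphD rmorphM /= map_polyX map_polyC comp_polyD comp_polyM comp_polyX comp_polyC.
rewrite -IHg /= pFrobenius_autE polyC_exp -exprMn.
by rewrite -!(pFrobenius_autE pcharP) rmorphD.
Qed.

Lemma coef_polyXp (g : {poly R}) i : (g ^+ p)`_(i * p) = g`_i ^+ p.
Proof. by rewrite polyXp coef_comp_poly_Xn // dvdn_mull // mulnK // coef_map. Qed.

(** A zero derivative leaves only exponents divisible by [p]; since Frobenius is additive, p-th
    roots can be taken term by term. *)
Lemma poly_pth_root (f : {poly R}) :
  f^`() = 0 -> (forall i, exists r, r ^+ p = f`_i) -> exists g, g ^+ p = f.
Proof.
move=> f'0 fX.
have fX' i : exists r, r ^+ p == f`_i by have [r /eqP] := fX i; exists r.
pose r i := xchoose (fX' i); have rE i : r i ^+ p = f`_i by apply/eqP/(xchooseP (fX' i)).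
exists (\poly_(i < size f) r (i * p)%N); apply/polyP => i.
rewrite polyXp coef_comp_poly_Xn //; case: ifP => [dv|/negbT ndv].
  rewrite coef_map coef_poly /=; case: ifP => [_|].
    by rewrite pFrobenius_autE rE divnK.
  move/negbT; rewrite -leqNgt => le; rewrite rmorph0 nth_default //.
  by rewrite (leq_trans le) // leq_div.
by rewrite deriv_eq0_coef.
Qed.
End PthPower.

(** * Separability of x: K = K^p[x] and the derivation d/dx *)

Lemma closed_nth_root (k : closedFieldType) (c : k) n : (0 < n)%N -> exists d, d ^+ n = c.
Proof.
move=> n_gt0; have /closed_rootP[d] : size ('X^n - c%:P) != 1.
  by rewrite size_XnsubC // eqSS -lt0n.
by rewrite /root !hornerE => /eqP/subr0_eq <-; exists d.
Qed.

Section Separable.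
Variables (k : closedFieldType) (K : fieldType) (iota : {rmorphism k -> K}) (p : nat).
Hypothesis pcharK : p \in [pchar K].
Variable x : K.
Hypothesis x_npow : forall z, z ^+ p != x.

Let p_prime : prime p := pcharf_prime pcharK.
Let p_gt0 : (0 < p)%N := prime_gt0 p_prime.

Let pchark : p \in [pchar k]. Proof. by rewrite -(fmorph_pchar iota). Qed.

Lemma pth_powers_subfield : subfield_closed (fun z : K => exists w, w ^+ p = z).
Proof.
split; first by exists 0; rewrite expr0n eqn0Ngt p_gt0.
split; first by exists 1; rewrite expr1n.
split; first by move=> _ _ [a <-] [b <-]; exists (a + b);
  rewrite -!(pFrobenius_autE pcharK) rmorphD.
split; first by move=> _ [a <-]; exists (- a); rewrite -!(pFrobenius_autE pcharK) rmorphN.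
split; first by move=> _ _ [a <-] [b <-]; exists (a * b); rewrite exprMn.
by move=> _ [a <-]; exists a^-1; rewrite exprVn.
Qed.

(** A simple root of a polynomial over $K^p$ whose p-th power is in $K^p$ lies in $K^p$ itself, and
    [x] does not. *)
Lemma pth_power_poly_deriv (f : {poly K}) :
  (forall i, exists w, w ^+ p = f`_i) -> f.[x] = 0 -> f^`().[x] = 0.
Proof.
move=> Sf fx; apply/eqP/negPn/negP => f'x.
have [|w wx] := simple_root_in_subfield pth_powers_subfield pcharK Sf fx f'x.
  by exists x.
by have := x_npow w; rewrite wx eqxx.
Qed.

Lemma horner_map_deriv (F : {poly {poly k}}) (y : K) :
  (map_poly (map_poly iota) F).[y%:P]^`() =
  (map_poly (map_poly iota) (map_poly (@deriv k) F)).[y%:P].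
Proof.
elim/poly_ind: F => [|F c IHF]; first by rewrite !raddf0 !horner0 deriv0.
have -> : map_poly (@deriv k) (F * 'X + c%:P) = map_poly (@deriv k) F * 'X + c^`()%:P.
  apply/polyP => i; rewrite !(coef_map, coefD, coefMX, coefC) /= derivD.
  by case: i => [|i] /=; rewrite ?deriv0 ?coef_map.
rewrite !rmorphD !rmorphM /= !map_polyX !map_polyC !hornerE /=.
by rewrite derivD derivM derivC mulr0 addr0 IHF deriv_map.
Qed.

(** If $P_Y = 0$, only powers of $y^p$ occur in $P(T, y)$; as [k] is perfect, its coefficients are
    p-th powers, and [pth_power_poly_deriv] applies to it at $T = x$. *)
Lemma eval2_deriv_eq0 (P : {poly {poly k}}) y :
  P^`() = 0 -> eval2 iota P x y = 0 -> eval2 iota (map_poly (@deriv k) P) x y = 0.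
Proof.
rewrite !eval2_horner2 -horner_map_deriv => P'0; apply: pth_power_poly_deriv => i.
rewrite horner_coef coef_sum.
apply: (subfield_closed_sum pth_powers_subfield) => j _.
rewrite coef_map /= -polyC_exp coefMC coef_map /=.
have pcharP : p \in [pchar {poly k}] by rewrite pchar_poly.
have [/dvdnP[q ->]|ndv] := boolP (p %| j)%N.
  have [d <-] := closed_nth_root (P`_(q * p)`_i) p_gt0.
  by exists (iota d * y ^+ q); rewrite exprMn rmorphXn exprM.
exists 0; rewrite (deriv_eq0_coef pcharP P'0 ndv) coef0 rmorph0 mul0r.
by rewrite expr0n eqn0Ngt p_gt0.
Qed.

(* Descent on the bidegree of P. If P_Y = 0 then P(T, y) has coefficients in K^p,
   so x is not a simple root of it and P_X vanishes at (x, y) as well; if both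
   partial derivatives of P are zero then P is a p-th power, k being perfect. *)
Lemma separable_relation (P : {poly {poly k}}) y :
    P != 0 -> eval2 iota P x y = 0 ->
  exists Q, eval2 iota Q x y = 0 /\ eval2 iota Q^`() x y != 0.
Proof.
have pcharP : p \in [pchar {poly k}] by rewrite pchar_poly.
have p_gt1 := prime_gt1 p_prime.
have [m Pm] : exists m, forall i : nat, ((size (P`_i)%R).-1 <= m)%N.
  exists (\max_(i < size P) (size (P`_i)%R).-1) => i.
  case: (ltnP i (size P)) => [lti|?]; last by rewrite nth_default // size_poly0.
  exact: (leq_bigmax (Ordinal lti)).
(* The measure is the degree in $Y$ plus a bound [m] on the degree in $X$. Passing to $P_Y$ lowers
   the first, to $P_X$ the second, and a p-th root divides both by [p]. *)
have [n] := ubnP ((size P).-1 + m); elim: n => // n IHn in P m Pm *.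
rewrite ltnS => le_n nzP Py.
have [P'y|?] := eqVneq (eval2 iota P^`() x y) 0; last by exists P.
have [P'0|nzP'] := eqVneq P^`() 0; last first.
  apply: (IHn _ m _ _ nzP' P'y) => [i|].
    rewrite coef_deriv -scaler_nat.
    by apply: leq_trans (Pm i.+1); rewrite -!subn1 leq_sub2r // size_scale_leq.
  have := lt_size_deriv nzP; move: nzP'; rewrite -size_poly_gt0; lia.
have PXy := eval2_deriv_eq0 P'0 Py.
have [PX0|nzPX] := eqVneq (map_poly (@deriv k) P) 0; last first.
  have [m0|m_gt0] := posnP m.
    case/eqP: nzPX; apply/polyP => i; rewrite coef_map coef0 /=.
    have := Pm i; rewrite m0 leqn0 => sz; have /size1_polyC -> : (size (P`_i)%R <= 1)%N by lia.
    by rewrite derivC.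
  apply: (IHn _ m.-1 _ _ nzPX PXy) => [i|].
    rewrite coef_map /=; have [-> |nzi] := eqVneq P`_i 0.
      by rewrite deriv0 size_poly0.
    rewrite -!subn1 leq_sub2r // (leq_trans _ (Pm i)) //.
    by rewrite -ltnS prednK ?size_poly_gt0 // lt_size_deriv.
  have le_sz : (size (map_poly (@deriv k) P) <= size P)%N by exact: size_poly.
  by rewrite (leq_trans _ le_n) // -(prednK m_gt0) addnS ltnS leq_add2r -!subn1 leq_sub2r.
(* The root is extracted first from each coefficient, a polynomial over [k], then from [P]
   itself. *)
have [i|Q DQ] := poly_pth_root pcharP P'0.
  apply: (poly_pth_root pchark); last by move=> j; apply: closed_nth_root.
  by have := coef_map (@deriv k) P i; rewrite PX0 coef0.
have nzQ : Q != 0 by apply: contraNneq nzP => Q0; rewrite -DQ Q0 expr0n eqn0Ngt p_gt0.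
have Qy : eval2 iota Q x y = 0.
  move: Py; rewrite -DQ !eval2E rmorphXn horner_exp => /eqP.
  by rewrite expf_eq0 p_gt0 /= => /eqP.
have szQ := size_exp Q p; rewrite DQ in szQ.
apply: (IHn Q (m %/ p)%N) => // [i|].
  rewrite leq_divRL // -size_exp -coef_polyXp // DQ; exact: Pm.
(* Division by [p] decreases the measure unless it is 0; in that case [P] is a nonzero constant and
   cannot vanish at $(x, y)$. *)
have [/eqP|] := posnP ((size P).-1 + m)%N; last first.
  rewrite szQ => gt0; apply: leq_trans le_n; rewrite szQ.
  move: gt0; move: (size Q).-1 => a gt0.
  have [m0|m_gt0] := posnP m; first by rewrite m0 div0n; rewrite m0 in gt0; nia.
  have := ltn_Pdiv p_gt1 m_gt0; nia.
rewrite addn_eq0 => /andP[/eqP sz0 /eqP m0]; exfalso.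
have DP : P = (P`_0)%:P by apply: size1_polyC; lia.
have DP0 : P`_0 = (P`_0`_0)%:P by apply: size1_polyC; have := Pm 0%N; lia.
case/eqP: nzP; move: Py; rewrite DP DP0 eval2E map_polyC hornerC /= evalpC => /eqP.
by rewrite fmorph_eq0 => /eqP ->.
Qed.

(** The ring $K^p[x]$ is closed under inversion because $a^{-1} = (a^{-1})^p a^{p-1}$. *)
Lemma pth_power_span_subfield :
  subfield_closed (fun y => exists g, (map_poly (pFrobenius_aut pcharK) g).[x] = y).
Proof.
have X y : (exists g, (map_poly (pFrobenius_aut pcharK) g).[x] = y) ->
    forall n, exists g, (map_poly (pFrobenius_aut pcharK) g).[x] = y ^+ n.
  by move=> [g <-] n; exists (g ^+ n); rewrite rmorphXn horner_exp.
split; first by exists 0; rewrite rmorph0 horner0.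
split; first by exists 1; rewrite rmorph1 hornerC.
split; first by move=> _ _ [a <-] [b <-]; exists (a + b); rewrite rmorphD hornerD.
split; first by move=> _ [a <-]; exists (- a); rewrite rmorphN hornerN.
split; first by move=> _ _ [a <-] [b <-]; exists (a * b); rewrite rmorphM hornerM.
move=> a Sa; have [->|nza] := eqVneq a 0.
  by rewrite invr0; exists 0; rewrite rmorph0 horner0.
have [g Dg] := X a Sa p.-1; exists (a^-1 *: g).
rewrite map_polyZ hornerZ Dg /= pFrobenius_autE.
by rewrite -{1}(prednK p_gt0) exprS exprVn -mulrA mulVf ?mulr1 // expf_neq0.
Qed.

(** A separable relation makes [y] a simple root of a polynomial over $k[x] \subseteq K^p[x]$, while
    $y^p$ lies in $K^p$; hence [y] lies in the field $K^p[x]$. *)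
Lemma pth_power_span y :
    function_field iota -> transcendental iota x ->
  exists g, (map_poly (pFrobenius_aut pcharK) g).[x] = y.
Proof.
move=> ffK tr_x; have [P [nzP Py]] := function_field_algebraic tr_x y ffK.
have [Q [Qy Q'y]] := separable_relation nzP Py; rewrite eval2E in Qy.
apply: (simple_root_in_subfield pth_power_span_subfield pcharK _ Qy).
- move=> i; rewrite coef_map /= /evalp.
  apply: (subfield_closed_horner pth_power_span_subfield) => [j|]; last first.
    by exists 'X; rewrite map_polyX hornerX.
  rewrite coef_map /=; have [d <-] := closed_nth_root (Q`_i`_j) p_gt0.
  by exists (iota d)%:P; rewrite map_polyC hornerC /= pFrobenius_autE rmorphXn.
- by move: Q'y; rewrite eval2E deriv_map.
by exists y%:P; rewrite map_polyC hornerC.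
Qed.

(** Write $y = g(x)$ with [g] over $K^p$ and set $D y = g'(x)$. Two choices of [g] differ by a
    polynomial over $K^p$ vanishing at [x], whose derivative also vanishes there. *)
Lemma exists_derivation :
    function_field iota -> transcendental iota x ->
  exists D, kder iota D /\ D x = 1.
Proof.
move=> ffK tr_x; set Fr := map_poly (pFrobenius_aut pcharK).
have FrD g h : Fr (g + h) = Fr g + Fr h by exact: rmorphD.
have FrM g h : Fr (g * h) = Fr g * Fr h by exact: rmorphM.
have span y : exists g, (Fr g).[x] == y.
  by have [g /eqP] := pth_power_span y ffK tr_x; exists g.
pose D y := (Fr (xchoose (span y)))^`().[x].
have DE g : D (Fr g).[x] = (Fr g)^`().[x].
  apply/eqP; rewrite -subr_eq0 /D; set h := xchoose _.
  have hE : (Fr h).[x] = (Fr g).[x] by apply/eqP/(xchooseP (span _)).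
  rewrite -hornerN -hornerD -derivB -rmorphB; apply/eqP/pth_power_poly_deriv.
    by move=> i; rewrite coef_map /=; exists (h - g)`_i.
  by rewrite rmorphB hornerD hornerN hE subrr.
have spanP y : exists g, y = (Fr g).[x] by have [g /eqP <-] := span y; exists g.
exists D; split; last first.
  by have := DE 'X; rewrite /Fr map_polyX hornerX derivX hornerC.
split; [|split].
- move=> a b; have [g ->] := spanP a; have [h ->] := spanP b.
  by rewrite -hornerD -FrD !DE FrD derivD hornerD.
- move=> a b; have [g ->] := spanP a; have [h ->] := spanP b.
  rewrite -hornerM -FrM !DE FrM derivM hornerD !hornerM.
  by rewrite addrC [X in _ + X]mulrC.
move=> c; have [d <-] := closed_nth_root c p_gt0.
have := DE (iota d)%:P.
by rewrite /Fr map_polyC derivC horner0 hornerC /= pFrobenius_autE rmorphXn.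
Qed.
End Separable.

(** * Consequences of k being algebraically closed *)

Section ClosedBase.
Variables (k : closedFieldType) (K : fieldType) (iota : {rmorphism k -> K}).

Lemma transcendental_not_const y : (forall c, y != iota c) -> transcendental iota y.
Proof.
move=> y_nk q nzq; have [r Dq] := closed_field_poly_normal q.
rewrite Dq map_polyZ hornerZ mulf_neq0 ?fmorph_eq0 ?lead_coef_eq0 //.
rewrite rmorph_prod horner_prod prodf_seq_neq0; apply/allP => z _ /=.
by rewrite map_polyXsubC hornerXsubC subr_eq0.
Qed.

Lemma closed_field_avoid_roots (r : {poly K}) : r != 0 -> exists d, ~~ root r (iota d).
Proof.
(* The field [k] is infinite: it contains more distinct elements than [r] can have roots. *)
move=> nzr; have [s [us szs]] : exists s : seq k, uniq s /\ size s = size r.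
  elim: (size r) => [|n [s [us <-]]]; first by exists [::].
  have /closed_nonrootP[z] : \prod_(a <- s) ('X - a%:P) != 0.
    by rewrite monic_neq0 ?monic_prod_XsubC.
  by rewrite root_prod_XsubC => zs; exists (z :: s); rewrite /= zs us.
have [allr|/allPn[d _ nr]] := boolP (all (fun d => root r (iota d)) s); last by exists d.
have := @max_poly_roots K r (map iota s) nzr; rewrite all_map allr.
by rewrite map_inj_uniq ?us; [rewrite size_map szs ltnn => /(_ isT isT) | exact: fmorph_inj].
Qed.
End ClosedBase.

(** * Interpolation: K is spanned by powers of x over the fixed field of sigma *)

Section FixedSpan.
Variables (k K : fieldType) (iota : {rmorphism k -> K}) (p : nat).
Hypothesis pcharK : p \in [pchar K].
Variables (sigma : {rmorphism K -> K}) (x : K) (c : k).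
Hypothesis sigma_iota : forall a, sigma (iota a) = iota a.
Hypothesis sigma_p : forall y, iter p sigma y = y.
Hypotheses (c_neq0 : c != 0) (sigma_x : sigma x = x + iota c).

Let p_gt0 : (0 < p)%N. Proof. by rewrite prime_gt0 ?(pcharf_prime pcharK). Qed.

Lemma iter_sigma_x n : iter n sigma x = x + iota (c *+ n).
Proof.
elim: n => [|n IHn]; first by rewrite rmorph0 addr0.
by rewrite iterS IHn rmorphD sigma_x sigma_iota -addrA -rmorphD mulrS.
Qed.

Lemma sigma_iter_ordS y (j : 'I_p) : sigma (iter j sigma y) = iter (ordS j) sigma y.
Proof.
rewrite -iterS [nat_of_ord (ordS j)]/=; have := ltn_ord j.
rewrite leq_eqVlt => /predU1P[->|lt_j].
  by rewrite modnn sigma_p.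
by rewrite modn_small.
Qed.

(* Lagrange interpolation of the conjugates of y at the conjugates of x. *)
Lemma fixed_span y :
  exists h : {poly K}, (forall i, sigma h`_i = h`_i) /\ h.[x] = y.
Proof.
pose L (j : 'I_p) := \prod_(l < p | l != j) ('X - (iter l sigma x)%:P).
pose G := \sum_(j < p) iter j sigma y *: L j.
have sG : map_poly sigma G = G.
  rewrite /G rmorph_sum /= [RHS](reindex_inj (@ordS_inj p)); apply: eq_bigr => j _.
  rewrite map_polyZ /= sigma_iter_ordS rmorph_prod /= /L; congr (_ *: _).
  rewrite [RHS](reindex_inj (@ordS_inj p)) /=.
  apply: eq_big => [l|l _]; first by rewrite (inj_eq (@ordS_inj p)).
  by rewrite map_polyXsubC sigma_iter_ordS.
(* At [x] every [L j] with $j \ne 0$ vanishes, and [L o] takes the value [e], a constant that is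
   nonzero since [p] divides no [l] with $0 < l < p$. So dividing by [e] keeps the coefficients
   fixed by [sigma]. *)
pose o := Ordinal p_gt0; pose e := \prod_(l < p | l != o) - (c *+ l).
have De : (L o).[x] = iota e.
  rewrite horner_prod rmorph_prod; apply: eq_bigr => l _.
  by rewrite hornerXsubC iter_sigma_x rmorphN opprD addrA subrr sub0r.
have nze : iota e != 0.
  rewrite fmorph_eq0; apply/prodf_neq0 => l nzl; rewrite oppr_eq0 -mulr_natr.
  rewrite mulf_neq0 // -(fmorph_eq0 iota) rmorph_nat -(dvdn_pcharf pcharK).
  by rewrite gtnNdvd // lt0n.
have Gx : G.[x] = y * iota e.
  rewrite /G horner_sum (bigD1 o) //= hornerZ De big1 ?addr0 // => j nzj.
  rewrite hornerZ /L horner_prod (bigD1 o) /=; last by rewrite eq_sym.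
  by rewrite hornerXsubC subrr mul0r mulr0.
exists ((iota e)^-1 *: G); split=> [i|].
  by rewrite coefZ rmorphM fmorphV sigma_iota -coef_map sG.
by rewrite hornerZ Gx mulrC mulfK.
Qed.
End FixedSpan.

(** * Generation of K by x and one p-th power of a fixed element *)

Section Generation.
Variables (k : closedFieldType) (K : fieldType) (iota : {rmorphism k -> K}) (p : nat).
Hypothesis pcharK : p \in [pchar K].
Variables (sigma : {rmorphism K -> K}) (x : K) (c : k).
Hypothesis x_npow : forall z, z ^+ p != x.
Hypothesis ffK : function_field iota.
Hypothesis sigma_iota : forall a, sigma (iota a) = iota a.
Hypothesis sigma_p : forall y, iter p sigma y = y.
Hypotheses (c_neq0 : c != 0) (sigma_x : sigma x = x + iota c).

Let p_gt0 : (0 < p)%N. Proof. by rewrite prime_gt0 ?(pcharf_prime pcharK). Qed.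

Lemma transcendental_x : transcendental iota x.
Proof.
apply: transcendental_not_const => a; apply/eqP => xa.
have /eqP := sigma_x; rewrite xa sigma_iota -subr_eq0 opprD addrA subrr sub0r.
by rewrite oppr_eq0 fmorph_eq0 (negPf c_neq0).
Qed.

Let tr_x := transcendental_x.

(* [y] lies in k(x, b_1^p, .., b_r^p) for finitely many [b_i] fixed by sigma. *)
Definition fixed_pth_generated (y : K) : Prop :=
  exists B : seq K, (forall b, b \in B -> sigma b = b) /\
    forall P, subfield_closed P -> (forall a, P (iota a)) -> P x ->
      (forall b, b \in B -> P (b ^+ p)) -> P y.

Lemma fixed_pth_generatedD a b :
  fixed_pth_generated a -> fixed_pth_generated b -> fixed_pth_generated (a + b).
Proof.
move=> [A [sA gA]] [B [sB gB]]; exists (A ++ B); split=> [z|P sP Pk Px PAB].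
  by rewrite mem_cat => /orP[/sA|/sB].
case: (sP) => _ [_ [PD _]]; apply: PD; [apply: gA | apply: gB] => // z zin;
by apply: PAB; rewrite mem_cat zin ?orbT.
Qed.

Lemma fixed_pth_generatedM a b :
  fixed_pth_generated a -> fixed_pth_generated b -> fixed_pth_generated (a * b).
Proof.
move=> [A [sA gA]] [B [sB gB]]; exists (A ++ B); split=> [z|P sP Pk Px PAB].
  by rewrite mem_cat => /orP[/sA|/sB].
case: (sP) => _ [_ [_ [_ [PM _]]]]; apply: PM; [apply: gA | apply: gB] => // z zin;
by apply: PAB; rewrite mem_cat zin ?orbT.
Qed.

Lemma fixed_pth_generatedX n : fixed_pth_generated (x ^+ n).
Proof.
exists [::]; split=> // P sP Pk Px _; exact: subfield_closedX.
Qed.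

Lemma fixed_pth_generated_horner (f : {poly K}) :
  (forall i, fixed_pth_generated f`_i) -> fixed_pth_generated f.[x].
Proof.
move=> gf; rewrite horner_coef; elim/big_ind: _ => [|a b|i _].
- by exists [::]; split=> // P [].
- exact: fixed_pth_generatedD.
- exact/fixed_pth_generatedM/fixed_pth_generatedX.
Qed.

(** Combine $y = \sum g_i^p x^i$ with $g_i = \sum h_{ij} x^j$, the $h_{ij}$ fixed by [sigma]: then
    $g_i^p = \sum h_{ij}^p x^{pj}$. *)
Lemma fixed_pth_generated_all y : fixed_pth_generated y.
Proof.
have [g <-] := pth_power_span pcharK x_npow y ffK tr_x.
apply: fixed_pth_generated_horner => i; rewrite coef_map /=.
have [h [sh <-]] := fixed_span pcharK sigma_iota sigma_p c_neq0 sigma_x g`_i.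
rewrite horner_coef rmorph_sum /=.
elim/big_ind: _ => [|a b|j _]; [|exact: fixed_pth_generatedD|].
  by exists [::]; split=> // P [].
rewrite rmorphM rmorphXn /= !pFrobenius_autE -exprM.
apply: fixed_pth_generatedM; last exact: fixed_pth_generatedX.
exists [:: h`_j]; split=> [b|P _ _ _ Pb]; first by rewrite inE => /eqP ->.
by apply: Pb; rewrite inE.
Qed.

(** Dividing a relation by its gcd with its derivative makes it separable; [y] remains a root
    because the derivative, hence the gcd, does not vanish at [y]. *)
Lemma separable_poly_over_x y :
  exists2 q : {poly {fraction {poly k}}},
    root (map_poly (fracx tr_x) q) y & separable_poly q.
Proof.
have [P [nzP Py]] := function_field_algebraic tr_x y ffK.
have [Q [Qy Q'y]] := separable_relation pcharK x_npow nzP Py.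
pose f := map_poly (@tofrac _) Q; pose d := gcdp f f^`().
have fE : map_poly (fracx tr_x) f = map_poly (evalp iota x) Q by exact: map_fracx_tofrac.
have f'E : map_poly (fracx tr_x) f^`() = map_poly (evalp iota x) Q^`().
  by rewrite -!deriv_map fE.
have nzf : f != 0.
  by apply: contraNneq Q'y => f0; rewrite eval2E -f'E f0 deriv0 rmorph0 horner0.
exists (f %/ d); last exact: make_separable.
have /eqP := Qy; rewrite eval2E -fE -[f in map_poly _ f](divpK (dvdp_gcdl f f^`())).
rewrite rmorphM hornerM mulf_eq0 => /orP[//|dy].
case/negP: Q'y; rewrite eval2E -f'E -(divpK (dvdp_gcdr f f^`())) rmorphM hornerM.
by rewrite (eqP dy) mulr0.
Qed.

Lemma fracx_closed (P : K -> Prop) q :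
  subfield_closed P -> (forall a, P (iota a)) -> P x -> P (fracx tr_x q).
Proof.
move=> sP Pk Px; have [n [d [_ ->]]] := fractionP q.
have Pev f : P (evalp iota x f).
  by apply: (subfield_closed_horner sP) => [i|] //; rewrite coef_map; apply: Pk.
rewrite fmorph_div !fracx_tofrac.
by case: (sP) => _ [_ [_ [_ [PM PV]]]]; apply: PM => //; apply: PV.
Qed.

(** The primitive element theorem over k(x) merges $\beta^p$ and $b^p$ into $d^p b^p - \beta^p = (d
    b - \beta)^p$, where $d^p \in k$ avoids finitely many values. Since [d] is in [k], $d b - \beta$
    is again fixed by [sigma]. *)
Lemma fixed_pth_primitive_seq (B : seq K) :
    (forall b, b \in B -> sigma b = b) ->
  exists beta, sigma beta = beta /\
    forall P, subfield_closed P -> (forall a, P (iota a)) -> P x ->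
      P (beta ^+ p) -> forall b, b \in B -> P (b ^+ p).
Proof.
elim: B => [|b B IHB] sB; first by exists 0; rewrite rmorph0.
have [b' b'B|be [s_be gen_be]] := IHB; first by apply: sB; rewrite inE b'B orbT.
have /eval2_algebraicOver[f nzf fbe] := function_field_algebraic tr_x (be ^+ p) ffK.
have [q qb sep_q] := separable_poly_over_x (b ^+ p).
have [r nzr rP] := large_field_PET nzf fbe qb sep_q.
have [d' d'P] := closed_field_avoid_roots iota nzr.
have [d Dd] := closed_nth_root d' p_gt0.
have [] := rP (tofrac d'%:P); first by rewrite fracx_tofrac evalpC.
rewrite fracx_tofrac evalpC -Dd.
have -> : iota (d ^+ p) * b ^+ p - be ^+ p = (iota d * b - be) ^+ p.
  by rewrite -!(pFrobenius_autE pcharK) rmorphB rmorphM /= !pFrobenius_autE rmorphXn.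
set z := iota d * b - be => -[q1 q1E] [q2 q2E].
exists z; split.
  by rewrite rmorphB rmorphM sigma_iota s_be sB ?mem_head.
move=> P sP Pk Px Pz.
have Pq (h : {poly {fraction {poly k}}}) : P (map_poly (fracx tr_x) h).[z ^+ p].
  apply: subfield_closed_horner => // i; rewrite coef_map; exact: fracx_closed.
move=> b'; rewrite inE => /predU1P[->|]; first by rewrite -q2E.
by apply: gen_be => //; rewrite -q1E.
Qed.

Lemma fixed_pth_primitive :
  exists beta, [/\ sigma beta = beta, forall a, beta != iota a &
    forall P, subfield_closed P -> (forall a, P (iota a)) -> P x ->
      P (beta ^+ p) -> forall y, P y].
Proof.
have [[s gen_s] _] := ffK.
have [B [sB gB]] : exists B : seq K, (forall b, b \in B -> sigma b = b) /\
    forall P, subfield_closed P -> (forall a, P (iota a)) -> P x ->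
      (forall b, b \in B -> P (b ^+ p)) -> forall y, y \in s -> P y.
  elim: (s) => [|y s' [B [sB gB]]]; first by exists [::].
  have [A [sA gA]] := fixed_pth_generated_all y.
  exists (A ++ B); split=> [z|P sP Pk Px PAB z].
    by rewrite mem_cat => /orP[/sA|/sB].
  rewrite inE => /predU1P[->|].
    by apply: gA => // b bA; apply: PAB; rewrite mem_cat bA.
  by apply: gB => // b bB; apply: PAB; rewrite mem_cat bB orbT.
have [be [s_be gen_be]] := fixed_pth_primitive_seq sB.
have gen P : subfield_closed P -> (forall a, P (iota a)) -> P x ->
    P (be ^+ p) -> forall y, P y.
  by move=> sP Pk Px Pbe; apply: gen_s => //; apply: gB => //; apply: gen_be.
have [[a Da]|nbe] := classic (exists a, be = iota a); last first.
  by exists be; split=> // a; apply/eqP => Da; apply: nbe; exists a.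
(* If [be] is constant then [x] alone generates [K], and any nonconstant fixed element will do. This
   one is fixed because $(x + c)^p - c^{p-1}(x + c) = x^p - c^{p-1} x$, and nonconstant because [x]
   is transcendental. *)
exists (x ^+ p - iota (c ^+ p.-1) * x); split.
- have cp : iota (c ^+ p.-1) * iota c = iota c ^+ p.
    by rewrite -rmorphM -exprSr prednK // rmorphXn.
  move: cp; move: (iota (c ^+ p.-1)) (sigma_iota (c ^+ p.-1)) => e se cp.
  rewrite rmorphB rmorphM rmorphXn /= sigma_x se.
  rewrite -!(pFrobenius_autE pcharK) rmorphD /= !pFrobenius_autE mulrDr cp.
  by rewrite opprD addrACA subrr addr0.
- move=> a'; have := tr_x; move/(_ ('X^p - (c ^+ p.-1) *: 'X - a'%:P)).
  rewrite -/(evalp iota x _) !rmorphB /= [evalp iota x 'X^p]rmorphXn /= evalpC evalpX.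
  rewrite -mul_polyC rmorphM /= evalpC evalpX => nz; rewrite -subr_eq0; apply: nz.
  rewrite -size_poly_eq0 -addrA size_polyDl size_polyXn //.
  rewrite (leq_ltn_trans (size_polyD _ _)) // !size_polyN gtn_max.
  rewrite (leq_ltn_trans (size_polyC_leq1 _)) ?ltnS // andbT.
  rewrite mul_polyC (leq_trans (size_scale_leq _ _)) // size_polyX.
  exact: (prime_gt1 (pcharf_prime pcharK)).
move=> P sP Pk Px _; apply: gen => //.
by rewrite Da -rmorphXn.
Qed.
End Generation.

(** * Local parameters and k-derivations *)

Lemma local_parameter_npow (k K : fieldType) (iota : {rmorphism k -> K}) (x : K) n :
  x != 0 -> local_parameter iota x -> (1 < n)%N -> forall z, z ^+ n != x.
Proof.
move=> nzx [v [[vM [_ v1]] vx]] n_gt1 z; apply/eqP => zx.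
have nzz : z != 0.
  by apply: contraNneq nzx => z0; rewrite -zx z0 expr0n eqn0Ngt (ltnW n_gt1).
have vX m : v (z ^+ m) = v z *+ m.
  elim: m => [|m IHm]; last by rewrite exprS vM ?expf_neq0 // IHm mulrS.
  by rewrite expr0 -(rmorph1 iota) v1 ?oner_eq0.
(* The valuation of $z^n$ is a multiple of [n], whereas [v x] is 1. *)
have := congr1 absz vx; rewrite -zx vX -mulr_natr abszM natz => /eqP.
by rewrite muln_eq1 /= => /andP[_ /eqP n1]; rewrite n1 in n_gt1.
Qed.

Section Derivation.
Variables (k K : fieldType) (iota : {rmorphism k -> K}) (D : K -> K).
Hypothesis kD : kder iota D.

Lemma kderD a b : D (a + b) = D a + D b. Proof. by case: kD. Qed.
Lemma kderM a b : D (a * b) = a * D b + b * D a. Proof. by case: kD => _ []. Qed.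
Lemma kder_const c : D (iota c) = 0. Proof. by case: kD => _ []. Qed.

Lemma kder1 : D 1 = 0. Proof. by have := kder_const 1; rewrite rmorph1. Qed.
Lemma kder0 : D 0 = 0. Proof. by have := kder_const 0; rewrite rmorph0. Qed.

Lemma kderZ c a : D (iota c * a) = iota c * D a.
Proof. by rewrite kderM kder_const mulr0 addr0. Qed.

Lemma kder_sum (I : Type) (r : seq I) (F : I -> K) :
  D (\sum_(i <- r) F i) = \sum_(i <- r) D (F i).
Proof. exact: (big_morph D kderD kder0). Qed.

Lemma kderX a n : D (a ^+ n) = a ^+ n.-1 * D a *+ n.
Proof.
case: n => [|n]; first by rewrite kder1.
elim: n => [|n IHn]; first by rewrite mul1r.
by rewrite exprS kderM IHn mulrnAr mulrA -exprS [a ^+ n.+1 * D a *+ n.+2]mulrSr.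
Qed.

Lemma kderXp p a : p \in [pchar K] -> D (a ^+ p) = 0.
Proof. by move=> pcharK; rewrite kderX -mulr_natr (pcharf0 pcharK) mulr0. Qed.
End Derivation.

(** * The coordinates of phi and their linear independence over k *)

Definition nonclassical_coord (K : fieldType) (x f a : K) (i : nat) : K :=
  match i with 0 => 1 | 1 => x | 2 => f | j.+3 => a ^+ j.+1 end.

Lemma nonclassical_coord_free (k K : fieldType) (iota : {rmorphism k -> K})
    (D : K -> K) (x f a : K) n (w : nat -> k) :
    kder iota D -> D x = 1 -> D f = 2%:R * x -> (2%:R : K) != 0 ->
    (forall m, D (a ^+ m) = 0) -> transcendental iota a ->
    \sum_(i < n.+3) iota (w i) * nonclassical_coord x f a i = 0 ->
  forall i, (i < n.+3)%N -> w i = 0.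
Proof.
move=> kD Dx Df nz2 Da tr_a.
rewrite !big_ord_recl /= mulr1 => w0.
(* One application of [D] leaves $w_1 + 2 w_2 x = 0$, a second one $2 w_2 = 0$. *)
have := congr1 D w0.
rewrite !(kderD kD) !(kderZ kD) (kder_sum kD) (kder_const kD) (kder0 kD).
rewrite [\sum_(_ < n) _]big1 => [|i _]; last by rewrite (kderZ kD) Da mulr0.
rewrite Dx Df add0r addr0 mulr1 => w1; have := congr1 D w1.
rewrite (kderD kD) (kderZ kD) (kder_const kD) (kder0 kD).
rewrite -(rmorph_nat iota) (kderZ kD) Dx mulr1 add0r rmorph_nat => /eqP.
rewrite mulf_eq0 (negPf nz2) orbF fmorph_eq0 => /eqP w2z.
move: w1; rewrite w2z rmorph0 mul0r addr0 => /eqP; rewrite fmorph_eq0 => /eqP w1z.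
move: w0; rewrite w1z w2z rmorph0 !mul0r !add0r => w0.
(* What remains is a polynomial relation for the transcendental [a]: coordinate 0 is its constant
   term, and coordinate [j.+3] its term of degree [j.+1]. *)
pose q := \poly_(i < n.+1) (if i is j.+1 then w j.+3 else w 0).
have q0 : q = 0.
  apply/eqP/negPn/negP => /tr_a; rewrite -/(evalp iota a q) /q poly_def rmorph_sum.
  rewrite big_ord_recl /= expr0 alg_polyC evalpC.
  under eq_bigr do rewrite -mul_polyC rmorphM rmorphXn /= evalpC evalpX.
  by rewrite w0 eqxx.
have qE i : (i < n.+1)%N -> (if i is j.+1 then w j.+3 else w 0) = 0.
  move=> lti; have := coef_poly n.+1 (fun i => if i is j.+1 then w j.+3 else w 0) i.
  by rewrite -/q q0 coef0 lti.
case=> [|[|[|i]]] // lti; first exact: (qE 0%N).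
exact: (qE i.+1).
Qed.

(** * The map phi and its Gauss map *)

Theorem theorem1p6 (k : closedFieldType) (p N : nat) (K : fieldType)
    (iota : {rmorphism k -> K}) :
  p \in [pchar k] -> (2 < p)%N -> (3 <= N)%N -> function_field iota ->
  forall (x : K) (sigma : {rmorphism K -> K}),
    local_parameter iota x -> k_automorphism iota sigma ->
    (exists c : k, c != 0 /\ sigma x - x = iota c) ->
    has_order sigma p ->
    exists phi : 'I_N.+1 -> K,
      [/\ birational_onto_image iota phi,
          not_in_hyperplane iota phi,
          (exists D, kder iota D /\ D x = 1)
        & forall D, kder iota D -> D x = 1 ->
            non_classical sigma phi D /\ gauss_birational iota phi D].
Proof.
move=> pchark p_gt2; case: N => [|[|[|N]]] // _ ffK x sigma lp_x.
move=> [_ sigma_iota] [c [nzc sx]] [sigma_p _].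
have {sx} sigma_x : sigma x = x + iota c by rewrite -sx addrC subrK.
have pcharK : p \in [pchar K] by rewrite (fmorph_pchar iota).
have nzic : iota c != 0 by rewrite fmorph_eq0.
have nzx : x != 0.
  apply: contraNneq nzic => x0; move: sigma_x.
  by rewrite x0 rmorph0 add0r => <-.
have x_npow := local_parameter_npow nzx lp_x (ltnW p_gt2).
have tr_x := transcendental_x sigma_iota nzc sigma_x.
have [be [s_be be_nk gen]] :=
  fixed_pth_primitive pcharK x_npow ffK sigma_iota sigma_p nzc sigma_x.
have nz2 : 2%:R != 0 :> K.
  by rewrite -(dvdn_pcharf pcharK) gtnNdvd.
pose a := be ^+ p.
have p_gt0 : (0 < p)%N by rewrite (ltn_trans _ p_gt2).
(* If [a] were a constant then so would be [be], as [k] has p-th roots and Frobenius is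
   injective. *)
have tr_a : transcendental iota a.
  apply: transcendental_not_const => b; have [d <-] := closed_nth_root b p_gt0.
  apply: contraNneq (be_nk d); rewrite rmorphXn /a -!(pFrobenius_autE pcharK).
  by move/fmorph_inj ->.
have sa : sigma a = a by rewrite rmorphXn s_be.
(* Here $\sigma(x^2) - x^2 = 2cx + c^2$ exceeds $c D(x^2)$ by $c^2$. The multiple of $x^p$ removes
   this excess without changing the derivative. *)
pose f := x ^+ 2 - iota (c ^+ 2 / c ^+ p) * x ^+ p.
pose phi (i : 'I_N.+4) := nonclassical_coord x f a i.
have Da D : kder iota D -> forall n, D (a ^+ n) = 0.
  by move=> kD n; rewrite exprAC (kderXp kD _ pcharK).
have Df D : kder iota D -> D x = 1 -> D f = 2%:R * x.
  move=> kD Dx; rewrite (kderD kD) -mulNr -rmorphN (kderZ kD) (kderXp kD _ pcharK).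
  by rewrite mulr0 addr0 (kderX kD) Dx mulr1 expr1 mulr_natl.
have exD : exists D, kder iota D /\ D x = 1 
  by exact: (exists_derivation pcharK x_npow ffK tr_x).
pose i0 : 'I_N.+4 := inord 0; pose i1 : 'I_N.+4 := inord 1.
pose i2 : 'I_N.+4 := inord 2; pose i3 : 'I_N.+4 := inord 3.
have [phi0 phi1 phi2 phi3] : [/\ phi i0 = 1, phi i1 = x, phi i2 = f & phi i3 = a].
  by rewrite /phi /i0 /i1 /i2 /i3 !inordK.
exists phi; split=> //.
- split; first by exists i0; rewrite phi0 oner_neq0.
  move=> P sP Pk Ps; apply: gen => //.
    by apply: Ps; exists i1, i0; rewrite phi0 phi1 oner_neq0 divr1.
  by apply: Ps; exists i3, i0; rewrite phi0 phi3 oner_neq0 divr1.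
- move=> u u0 i; have [D [kD Dx]] := exD.
  have := @nonclassical_coord_free _ _ iota D x f a N.+1 (fun i => u (inord i)) kD Dx
    (Df D kD Dx) nz2 (Da D kD) tr_a _ i (ltn_ord i).
  rewrite inord_val; apply; rewrite -[RHS]u0; apply: eq_bigr => j _.
  by rewrite inord_val.
move=> D kD Dx; split.
  split; first by exists x; rewrite sigma_x -subr_eq0 addrC addKr.
  exists 1, (iota c); case=> [[|[|[|i]]] lti]; rewrite /phi /= mul1r.
  - by rewrite rmorph1 (kder1 kD) mulr0 addr0.
  - by rewrite Dx mulr1.
  - rewrite (Df D kD Dx) /f; have ec : iota (c ^+ 2 / c ^+ p) * iota c ^+ p = iota c ^+ 2.
      by rewrite -rmorphXn -rmorphM divfK ?rmorphXn // expf_neq0.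
    move: ec; move: (iota (c ^+ 2 / c ^+ p)) (sigma_iota (c ^+ 2 / c ^+ p)) => e se ec.
    rewrite [LHS]rmorphB rmorphXn [sigma (e * _)]rmorphM rmorphXn /= sigma_x se.
    rewrite -(pFrobenius_autE pcharK (x + _)) rmorphD /= !pFrobenius_autE mulrDr ec.
    by move: (e * x ^+ p) => y; ring.
  - by rewrite rmorphXn sa Da // mulr0 addr0.
(* With one coordinate equal to 1, the ratios include all the Pluecker coordinates themselves. *)
have P01 : plucker phi D i0 i1 = 1.
  by rewrite /plucker phi0 phi1 Dx (kder1 kD) mulr0 subr0 mulr1.
move=> P sP Pk Ps.
have [_ [_ [_ [PN [PM PV]]]]] := sP.
have Ppl i j : P (plucker phi D i j).
  by apply: Ps; exists i, j, i0, i1; rewrite P01 oner_neq0 divr1.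
have P2 : P (plucker phi D i0 i2) by [].
have P3 : P (plucker phi D i1 i3) by [].
move: P2 P3; rewrite /plucker phi0 phi1 phi2 phi3 Df // Dx (kder1 kD).
rewrite -[a]expr1 Da // !mulr0 mul1r mulr1 subr0 sub0r expr1 => P2 P3.
apply: gen => //; last by rewrite -/a -[a]opprK; apply: PN.
(* [x] is recovered from $2x$, as 2 is invertible for $p > 2$. *)
by rewrite -(mulKf nz2 x); apply: PM => //; rewrite -(rmorph_nat iota); apply: PV.
Qed.
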